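(* Let $\mathcal V_3$ be the variety generated by all semirings of order three, let $\mathcal A_3$ be the variety generated by all ai-semirings of order three, and let $\mathbf{AI}$ be the variety of all ai-semirings. Then \[ \mathcal V_3\cap\mathbf{AI}=\mathcal A_3 . \]
   Context: A semiring is a nonempty algebra $(S,+,\cdot)$ in the signature of two binary operations (no constants) in which both operations are associative and multiplication distributes over addition on both sides; neither addition nor multiplication is assumed commutative. An ai-semiring is a semiring whose addition is both commutative and idempotent ($x+x=x$); its multiplication need not be commutative. The variety generated by a class of algebras is the smallest class containing it closed under homomorphic images, subalgebras and arbitrary direct products. *)

(* Defs.v *)
From mathcomp Require Import all_boot boolp.

Set Implicit Arguments.
Unset Strict Implicit.
Unset Printing Implicit Defensive.

(* MathComp's own semirings carry constants and a commutative addition, so the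
   bare signature of two binary operations is set up here. *)
Record algebra : Type := Algebra {
  carrier :> Type;
  add : carrier -> carrier -> carrier;
  mul : carrier -> carrier -> carrier;
  carrier_inhabited : inhabited carrier
}.

Arguments add {a}.
Arguments mul {a}.

(* Plain predicates rather than [set algebra]: the latter would force the universe
   of carriers strictly below that of MathComp's finite types such as ['I_3]. *)
Definition algebra_class := algebra -> Prop.

Definition is_semiring (S : algebra) : Prop :=
  [/\ associative (@add S), associative (@mul S),
      left_distributive (@mul S) (@add S) &
      right_distributive (@mul S) (@add S)].

Definition is_ai_semiring (S : algebra) : Prop :=
  [/\ is_semiring S, commutative (@add S) & idempotent_op (@add S)].

Definition has_order_three (A : algebra) : Prop :=
  exists f : 'I_3 -> A, bijective f.

Definition is_hom (A B : algebra) (f : A -> B) : Prop :=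
  {morph f : x y / add x y} /\ {morph f : x y / mul x y}.

Section Subalgebra.
Variables (A : algebra) (P : A -> Prop) (P_nonempty : exists x, P x).
Hypothesis P_add : forall x y, P x -> P y -> P (add x y).
Hypothesis P_mul : forall x y, P x -> P y -> P (mul x y).

Lemma subalgebra_inhabited : inhabited {x : A | P x}.
Proof. by case: P_nonempty => x Px; split; exists x. Qed.

Definition subalgebra : algebra :=
  @Algebra {x : A | P x}
    (fun x y => exist P (add (sval x) (sval y)) (P_add (svalP x) (svalP y)))
    (fun x y => exist P (mul (sval x) (sval y)) (P_mul (svalP x) (svalP y)))
    subalgebra_inhabited.

End Subalgebra.

Lemma product_inhabited (I : Type) (F : I -> algebra) :
  inhabited (forall i, F i).
Proof. exact: (inhabits (fun i => inhabited_witness (carrier_inhabited (F i)))). Qed.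

Definition product_algebra (I : Type) (F : I -> algebra) : algebra :=
  @Algebra (forall i, F i)
    (fun x y i => add (x i) (y i))
    (fun x y i => mul (x i) (y i))
    (product_inhabited F).

Definition closed_under_images (C : algebra_class) : Prop :=
  forall (A B : algebra) (f : A -> B),
    is_hom f -> (forall y, exists x, f x = y) -> C A -> C B.

Definition closed_under_subalgebras (C : algebra_class) : Prop :=
  forall (A : algebra) (P : A -> Prop) (P_nonempty : exists x, P x)
    (P_add : forall x y, P x -> P y -> P (add x y))
    (P_mul : forall x y, P x -> P y -> P (mul x y)),
    C A -> C (subalgebra P_nonempty P_add P_mul).

(* The index type ranges over the universe of carriers; empty products, which
   are one-element algebras, are included. *)
Definition closed_under_products (C : algebra_class) : Prop :=
  forall (I : Type) (F : I -> algebra),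
    (forall i, C (F i)) -> C (product_algebra F).

Definition closed_HSP (C : algebra_class) : Prop :=
  [/\ closed_under_images C, closed_under_subalgebras C &
      closed_under_products C].

Definition variety_generated (K : algebra_class) : algebra_class :=
  fun A => forall C : algebra_class,
    closed_HSP C -> (forall B, K B -> C B) -> C A.

Definition semirings_of_order_three : algebra_class :=
  fun S => is_semiring S /\ has_order_three S.

Definition ai_semirings_of_order_three : algebra_class :=
  fun S => is_ai_semiring S /\ has_order_three S.

Definition V3 : algebra_class := variety_generated semirings_of_order_three.

Definition A3 : algebra_class := variety_generated ai_semirings_of_order_three.

Definition AI : algebra_class := is_ai_semiring.

(* Main.v *)
(* If t = u is an identity of all ai-semirings of order three, then
   6t + 6u + 6t = 6t holds in every semiring S of order three, commutative
   addition or not: "6x + 6y + 6x = 6x and 6y + 6x + 6y = 6y" is a congruence on S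
   whose quotient is an ai-semiring with at most three elements, and such a
   quotient satisfies t = u.  That law passes to all of V3, and in an ai-semiring
   it reads t + u = t; by symmetry t = u.  So an ai-semiring in V3 satisfies every
   identity of A3 and lies in A3 by Birkhoff's theorem. *)
From mathcomp Require Import all_boot boolp.
Require Import Defs.

Set Implicit Arguments.
Unset Strict Implicit.
Unset Printing Implicit Defensive.

(** * Transfer of the semiring laws along homomorphisms *)

Section Transfer.
Variables (A B : algebra) (f : A -> B).
Hypothesis f_hom : is_hom f.

Lemma is_semiring_inj : injective f -> is_semiring B -> is_semiring A.
Proof.
move: f_hom => [fD fM] f_inj [DA MA DL DR].
split=> x y z; apply: f_inj; rewrite !(fD, fM) ?(fD, fM).
- exact: DA.
- exact: MA.
- exact: DL.
- exact: DR.
Qed.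

Lemma is_ai_semiring_inj : injective f -> is_ai_semiring B -> is_ai_semiring A.
Proof.
move=> f_inj [semiB DC DI]; split; first exact: is_semiring_inj.
- by move=> x y; apply: f_inj; rewrite !f_hom.1 DC.
- by move=> x; apply: f_inj; rewrite f_hom.1 DI.
Qed.

Lemma is_semiring_surj :
  (forall y, exists x, f x = y) -> is_semiring A -> is_semiring B.
Proof.
move: f_hom => [fD fM] f_surj [DA MA DL DR].
split=> x y z; case: (f_surj x) (f_surj y) (f_surj z) => a <- [b <-] [c <-].
- by rewrite -!fD DA.
- by rewrite -!fM MA.
- by rewrite -!(fD, fM) DL !(fD, fM).
- by rewrite -!(fD, fM) DR !(fD, fM).
Qed.

Lemma is_ai_semiring_surj :
  (forall y, exists x, f x = y) -> is_ai_semiring A -> is_ai_semiring B.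
Proof.
move=> f_surj [semiA DC DI]; split; first exact: is_semiring_surj.
- move=> x y; case: (f_surj x) (f_surj y) => a <- [b <-].
  by rewrite -!f_hom.1 DC.
- by move=> x; case: (f_surj x) => a <-; rewrite -f_hom.1 DI.
Qed.

End Transfer.

Lemma sval_inj (T : Type) (P : T -> Prop) : injective (@sval T P).
Proof. by move=> x y; apply: eq_sig_hprop => z; apply: Prop_irrelevance. Qed.

(** Needed for the easy inclusion of [A3] in [AI]. *)
Lemma is_ai_semiring_closed : closed_HSP is_ai_semiring.
Proof.
split.
- by move=> A B f f_hom f_surj; apply: (is_ai_semiring_surj f_hom f_surj).
- move=> A P P0 PD PM; move=> aiA.
  apply: (@is_ai_semiring_inj (subalgebra P0 PD PM) A (@sval _ P)) => //.
  exact: sval_inj.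
- move=> I F aiF; split; first split.
  all: move=> *; apply: functional_extensionality_dep => i /=.
  all: by case: (aiF i) => [[DA MA DL DR] DC DI].
Qed.

Definition transport_algebra (T : Type) (T0 : inhabited T) (B : algebra)
    (f : T -> B) (g : B -> T) : algebra :=
  @Algebra T (fun x y => g (add (f x) (f y))) (fun x y => g (mul (f x) (f y))) T0.

Lemma transport_hom (T : Type) (T0 : inhabited T) (B : algebra)
    (f : T -> B) (g : B -> T) :
  cancel g f -> is_hom (f : transport_algebra T0 f g -> B).
Proof. by move=> gK; split=> x y /=; rewrite gK. Qed.

(** * Terms, identities and Birkhoff's theorem for order three *)

Inductive term (X : Type) : Type :=
| Var of X
| Add of term X & term X
| Mul of term X & term X.

Fixpoint eval (X : Type) (A : algebra) (v : X -> A) (t : term X) : A :=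
  match t with
  | Var x => v x
  | Add t u => add (eval v t) (eval v u)
  | Mul t u => mul (eval v t) (eval v u)
  end.

Lemma eval_hom (X : Type) (A B : algebra) (f : A -> B) (v : X -> A) (t : term X) :
  is_hom f -> f (eval v t) = eval (f \o v) t.
Proof. by case=> fD fM; elim: t => //= t IHt u IHu; rewrite (fD, fM) IHt IHu. Qed.

Lemma eval_product (X I : Type) (F : I -> algebra)
    (v : X -> product_algebra F) (t : term X) (i : I) :
  eval v t i = eval (fun x => v x i) t.
Proof. by elim: t => //= t -> u ->. Qed.

Definition ai3_identity (X : Type) (t u : term X) : Prop :=
  forall B, ai_semirings_of_order_three B -> forall v : X -> B, eval v t = eval v u.

(* [A] is an image of the subalgebra generated by the projections in the product
   of all order-three tables over all valuations; using tables on ['I_3] rather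
   than all algebras keeps the index type in the universe of carriers. *)
Lemma A3_of_identities (A : algebra) :
  (forall t u : term A, ai3_identity t u -> eval id t = eval id u) -> A3 A.
Proof.
move=> idA C [C_img C_sub C_prod] KC.
pose op := 'I_3 -> 'I_3 -> 'I_3.
pose alg (p : op * op) : algebra := Algebra p.1 p.2 (inhabits ord0).
pose F (i : {p | is_ai_semiring (alg p)} * (A -> 'I_3)) := alg (sval i.1).
pose P := product_algebra F.
pose gen (a : A) : P := fun i => i.2 a.
pose G (p : P) := exists t, p = eval gen t.
have G0 : exists p, G p.
  by have [a] := carrier_inhabited A; exists (gen a), (Var a).
have GD p q : G p -> G q -> G (add p q).
  by move=> [t ->] [u ->]; exists (Add t u).
have GM p q : G p -> G q -> G (mul p q).
  by move=> [t ->] [u ->]; exists (Mul t u).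
(* Every order-three ai-semiring [B] is isomorphic to a table [alg p], and a valuation [v] in it is
   read off at the coordinate [(p, g \o v)]. *)
have gen_id t u : eval gen t = eval gen u -> eval id t = eval id u.
  move=> eq_tu; apply: idA => B [aiB [f [g fK gK]]] v.
  pose p : op * op := (fun x y => g (add (f x) (f y)), fun x y => g (mul (f x) (f y))).
  have f_hom : is_hom (f : alg p -> B) by split=> x y /=; rewrite gK.
  have ai_p : is_ai_semiring (alg p).
    exact: (is_ai_semiring_inj f_hom (can_inj fK)).
  have := congr1 (fun h : P => f (h (exist _ p ai_p, g \o v))) eq_tu.
  rewrite !eval_product /F /= !(eval_hom _ _ f_hom).
  suff -> : f \o (fun a => g (v a)) = v by [].
  by apply: funext => a /=; rewrite gK.
(* [h] evaluates a chosen term representing [p]; by [gen_id] the choice does not matter. *)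
pose h (p : subalgebra G0 GD GM) : A := eval id (sval (cid (svalP p))).
have hE p t : sval p = eval gen t -> h p = eval id t.
  by move=> pE; apply: gen_id; rewrite -pE; case: (cid _).
apply: (C_img (subalgebra G0 GD GM) A h).
- split=> p q; case: (svalP p) (svalP q) => t pE [u qE].
    rewrite (hE p t pE) (hE q u qE); apply: (hE _ (Add t u)).
    by rewrite /= pE qE.
  rewrite (hE p t pE) (hE q u qE); apply: (hE _ (Mul t u)).
  by rewrite /= pE qE.
- move=> a; have Ga : G (gen a) by exists (Var a).
  by exists (exist _ _ Ga); exact: (hE (exist _ _ Ga) (Var a) erefl).
- apply: C_sub; apply: C_prod => i; apply: KC; split; first exact: (svalP i.1).
  by exists id; exists id.
Qed.

(** * Small ai-semirings and finite quotients *)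

(** [None] is a new element absorbing on both sides. Adjoining it for both operations raises the
    order by one and keeps the ai-semiring laws. *)
Definition add_top (T : Type) (op : T -> T -> T) (x y : option T) : option T :=
  if x is Some a then if y is Some b then Some (op a b) else None else None.

Lemma add_top_ai_semiring (T : Type) (T0 : inhabited T) (D M : T -> T -> T) :
  is_ai_semiring (Algebra D M T0) ->
  is_ai_semiring (Algebra (add_top D) (add_top M) (inhabits None)).
Proof.
move=> [[DA MA DL DR] DC DI]; split; first split.
- by move=> [x|] [y|] [z|] //=; congr Some; apply: DA.
- by move=> [x|] [y|] [z|] //=; congr Some; apply: MA.
- by move=> [x|] [y|] [z|] //=; congr Some; apply: DL.
- by move=> [x|] [y|] [z|] //=; congr Some; apply: DR.
- by move=> [x|] [y|] //=; congr Some; apply: DC.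
- by move=> [x|] //=; congr Some; apply: DI.
Qed.

Lemma ai3_identity_small (X : Type) (t u : term X) (T : finType)
    (T0 : inhabited T) (D M : T -> T -> T) :
  ai3_identity t u -> is_ai_semiring (Algebra D M T0) -> #|T| <= 3 ->
  forall v : X -> Algebra D M T0, eval v t = eval v u.
Proof.
(* Induction on the number of tops still to be adjoined; [Some] embeds each stage in the next. *)
move=> id_tu; have [n] := ubnP (3 - #|T|).
elim: n => // n IHn in T T0 D M *.
move=> lt_n aiT le_T3 v.
have [T3|T3] := eqVneq #|T| 3.
  apply: id_tu; split=> //; exists (fun i => enum_val (cast_ord (esym T3) i)).
  exists (fun x => cast_ord T3 (enum_rank x)) => x.
    by rewrite enum_valK cast_ordKV.
  by rewrite cast_ordK enum_rankK.
have lt_T3 : #|T| < 3 by rewrite ltn_neqAle T3.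
pose B := Algebra (add_top D) (add_top M) (inhabits None).
have some_hom : is_hom (Some : Algebra D M T0 -> B) by [].
suff: Some (eval v t) = Some (eval v u) by case.
rewrite !(eval_hom _ _ some_hom).
apply: IHn (add_top_ai_semiring aiT) _ _; rewrite card_option //.
by rewrite subnS -ltnS prednK ?subn_gt0.
Qed.

(** The quotient is realised on canonical representatives, so its carrier is a [finType] that
    injects into [T]. *)
Lemma finite_quotient (T : finType) (T0 : inhabited T) (D M : T -> T -> T)
    (R : rel T) :
    equivalence_rel R ->
    (forall x y z, R x y -> R (D x z) (D y z) && R (D z x) (D z y)) ->
    (forall x y z, R x y -> R (M x z) (M y z) && R (M z x) (M z y)) ->
  exists (Q : finType) (Q0 : inhabited Q) (DQ MQ : Q -> Q -> Q) (q : T -> Q),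
    [/\ #|Q| <= #|T|, forall y, exists x, q x = y,
        @is_hom (Algebra D M T0) (Algebra DQ MQ Q0) q &
        forall x y, (q x = q y) <-> R x y].
Proof.
move=> eqR RD RM.
have Rxx x : R x x by have [] := eqR x x x.
have R_eq x y : R x y -> R x =1 R y by move=> Rxy z; have [_ ->] := eqR x y z.
have R_sym x y : R x y -> R y x by move=> Rxy; rewrite -(R_eq _ _ Rxy).
(* The default is never reached, as [R] is reflexive. The pick depends only on the class of [x], so
   [r] is constant on classes. *)
pose r x := odflt x [pick y | R x y].
have Rr x : R x (r x) by rewrite /r; case: pickP => //= _; apply: Rxx.
have r_eq x y : R x y -> r x = r y.
  move=> Rxy; rewrite /r (eq_pick (R_eq _ _ Rxy)).
  by case: pickP => //= /(_ y); rewrite Rxx.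
have rr x : r (r x) == r x by apply/eqP/esym/r_eq.
pose Q : finType := {x | r x == x}.
pose q x : Q := exist _ (r x) (rr x).
have q_eq x y : (q x = q y) <-> R x y.
  split=> [/(congr1 val) /= rxy | /r_eq rxy]; last exact: val_inj.
  by rewrite (R_eq _ _ (Rr x)) rxy R_sym.
have q_op (op : T -> T -> T) :
    (forall x y z, R x y -> R (op x z) (op y z) && R (op z x) (op z y)) ->
  forall x y, q (op x y) = q (op (val (q x)) (val (q y))).
  move=> Rop x y; apply/q_eq.
  have /andP[Rx _] := Rop _ _ y (Rr x); have /andP[_ Ry] := Rop _ _ (r x) (Rr y).
  by rewrite (R_eq _ _ Rx).
exists Q, (let: inhabits x := T0 in inhabits (q x)).
exists (fun a b => q (D (val a) (val b))), (fun a b => q (M (val a) (val b))), q.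
split=> //.
- exact: leq_card val_inj.
- by move=> y; exists (val y); apply: val_inj; apply/eqP/(valP y).
- by split=> x y /=; apply: q_op.
Qed.

(** * The absorption congruence on tables with three elements *)

(* An additive semigroup of order three has index at most 3 and period at most 3,
   so [6x] is always idempotent. *)
Definition sextuple (T : Type) (op : T -> T -> T) (x : T) : T :=
  op (op (op x x) (op x x)) (op x x).

Definition absorbs (T : Type) (op : T -> T -> T) (x y : T) : Prop :=
  op (op (sextuple op x) (sextuple op y)) (sextuple op x) = sextuple op x.

(** Serves both for homomorphisms and for multiplication by a fixed element. *)
Lemma absorbs_morph (T U : Type) (opT : T -> T -> T) (opU : U -> U -> U)
    (f : T -> U) (x y : T) :
  {morph f : a b / opT a b >-> opU a b} -> absorbs opT x y ->
  absorbs opU (f x) (f y).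
Proof. by move=> fD; rewrite /absorbs /sextuple -!fD => ->. Qed.

Definition absorb_eq (T : eqType) (op : T -> T -> T) : rel T := fun x y =>
  (op (op (sextuple op x) (sextuple op y)) (sextuple op x) == sextuple op x) &&
  (op (op (sextuple op y) (sextuple op x)) (sextuple op y) == sextuple op y).

Lemma absorb_eqP (T : eqType) (op : T -> T -> T) (x y : T) :
  reflect (absorbs op x y /\ absorbs op y x) (absorb_eq op x y).
Proof. by apply: (iffP andP) => -[/eqP ? /eqP]. Qed.

(* The additive half of the congruence property is decided by running through all
   tables on [option bool], which computes better than ['I_3]; the multiplicative
   half is automatic because multiplication by an element is additive. *)
Definition exhausts (T : Type) (allT : (T -> bool) -> bool) : Prop :=
  forall P, allT P -> forall x, P x.

Definition all3 (P : option bool -> bool) : bool :=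
  [&& P None, P (Some true) & P (Some false)].

(** A function on [option bool] is its triple of values; nesting twice runs through all 3^9
    tables. *)
Definition all_fun3 (T : Type) (allT : (T -> bool) -> bool)
    (P : (option bool -> T) -> bool) : bool :=
  allT (fun a => allT (fun b => allT (fun c =>
    P (fun x => if x is Some y then if y then b else c else a)))).

Lemma all3_exhausts : exhausts all3.
Proof. by move=> P /and3P[? ? ?] [[]|]. Qed.

Lemma all_fun3_exhausts (T : Type) (allT : (T -> bool) -> bool) :
  exhausts allT -> exhausts (all_fun3 allT).
Proof.
move=> allTP P + f => /allTP /(_ (f None)) /allTP /(_ (f (Some true))).
move=> /allTP /(_ (f (Some false))); congr (is_true (P _)).
by apply: funext => -[[]|].
Qed.

(** [if] replaces [==>] because [vm_compute] evaluates arguments eagerly; non-associative tables are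
    thus dismissed at once. *)
Definition absorb_eq_check (op : option bool -> option bool -> option bool) : bool :=
  let R := absorb_eq op in
  if all3 (fun x => all3 (fun y => all3 (fun z => op x (op y z) == op (op x y) z)))
  then all3 (fun x => R x x && R (op x x) x && all3 (fun y => R (op x y) (op y x) &&
    (if R x y then all3 (fun z =>
       [&& R x z == R y z, R (op x z) (op y z) & R (op z x) (op z y)])
     else true)))
  else true.

Lemma absorb_eq_check_all : all_fun3 (all_fun3 all3) absorb_eq_check.
Proof. by vm_compute. Qed.

(** The last two clauses make addition in the quotient commutative and idempotent. *)
Lemma absorb_eq_congruence (op : option bool -> option bool -> option bool) :
  associative op ->
  [/\ equivalence_rel (absorb_eq op),
      forall x y z, absorb_eq op x y ->
        absorb_eq op (op x z) (op y z) && absorb_eq op (op z x) (op z y),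
      forall x y, absorb_eq op (op x y) (op y x) &
      forall x, absorb_eq op (op x x) x].
Proof.
move=> opA.
have := all_fun3_exhausts (all_fun3_exhausts all3_exhausts) absorb_eq_check_all op.
rewrite /absorb_eq_check ifT => [H|]; last by rewrite /all3 !opA !eqxx.
have {}H x := all3_exhausts H x.
have Hxx x : absorb_eq op x x by case/andP: (H x) => /andP[].
have Hx2 x : absorb_eq op (op x x) x by case/andP: (H x) => /andP[].
have {}H x y := all3_exhausts (proj2 (andP (H x))) y.
have Hxy x y : absorb_eq op (op x y) (op y x) by case/andP: (H x y).
have {}H x y z : absorb_eq op x y ->
    [&& absorb_eq op x z == absorb_eq op y z,
        absorb_eq op (op x z) (op y z) & absorb_eq op (op z x) (op z y)].
  by move=> Rxy; have /andP[_] := H x y; rewrite Rxy => /all3_exhausts.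
split=> //.
- by move=> x y z; split=> // /(H x y z) /and3P[/eqP].
- by move=> x y z /(H x y z) /and3P[_ -> ->].
Qed.

(** * The absorption laws throughout [V3] *)

Definition satisfies_absorption (X : Type) (A : algebra) : Prop :=
  forall t u : term X, ai3_identity t u ->
  forall v : X -> A, absorbs add (eval v t) (eval v u).

Lemma satisfies_absorption_closed (X : Type) : closed_HSP (@satisfies_absorption X).
Proof.
split.
- move=> A B f f_hom f_surj absA t u id_tu v.
  (* A section of [f] lifts the valuation to [A]. *)
  have [g gK] := choice f_surj.
  have -> : v = f \o (g \o v) by apply: funext => x /=; rewrite gK.
  rewrite -!(eval_hom _ _ f_hom); apply: absorbs_morph (absA _ _ id_tu _).
  exact: f_hom.1.
- move=> A P P0 PD PM absA t u id_tu v; apply: sval_inj.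
  have s_hom : is_hom (@sval _ P : subalgebra P0 PD PM -> A) by [].
  have := absA _ _ id_tu (@sval _ P \o v).
  by rewrite -!(eval_hom _ _ s_hom).
- move=> I F absF t u id_tu v; apply: functional_extensionality_dep => i.
  by have := absF i _ _ id_tu (fun x => v x i); rewrite -!eval_product.
Qed.

Lemma satisfies_absorption_table (X : Type)
    (D M : option bool -> option bool -> option bool) (T0 : inhabited (option bool)) :
  is_semiring (Algebra D M T0) -> satisfies_absorption X (Algebra D M T0).
Proof.
move=> semiT t u id_tu v; case: (semiT) => /= DA MA DL DR.
have [eqR RD RC RI] := absorb_eq_congruence DA.
have RM x y z : absorb_eq D x y ->
    absorb_eq D (M x z) (M y z) && absorb_eq D (M z x) (M z y).
  have ML : {morph M^~ z : a b / D a b} by move=> a b; apply: DL.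
  have MR : {morph M z : a b / D a b} by move=> a b; apply: DR.
  move=> /absorb_eqP[xy yx]; apply/andP; split; apply/absorb_eqP; split.
  - exact: absorbs_morph ML xy.
  - exact: absorbs_morph ML yx.
  - exact: absorbs_morph MR xy.
  - exact: absorbs_morph MR yx.
have [Q [Q0 [DQ [MQ [q [leQ q_surj q_hom q_eq]]]]]] := finite_quotient T0 eqR RD RM.
have aiQ : is_ai_semiring (Algebra DQ MQ Q0).
  split; first exact: is_semiring_surj q_hom q_surj semiT.
  - move=> a b; case: (q_surj a) (q_surj b) => x <- [y <-].
    by rewrite -!q_hom.1; apply/q_eq/RC.
  - by move=> a; case: (q_surj a) => x <-; rewrite -q_hom.1; apply/q_eq/RI.
have le_Q3 : #|Q| <= 3 by apply: leq_trans leQ _; rewrite card_option card_bool.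
have := ai3_identity_small id_tu aiQ le_Q3 (q \o v).
(* Equality of the two values in the quotient is mutual absorption in the table. *)
by rewrite -!(eval_hom _ _ q_hom) => /q_eq /absorb_eqP[].
Qed.

Lemma satisfies_absorption_order_three (X : Type) (S : algebra) :
  semirings_of_order_three S -> satisfies_absorption X S.
Proof.
move=> [semiS [f [g fK gK]]].
have card3 : #|{: option bool}| = 3 by rewrite card_option card_bool.
pose e (x : option bool) : S := f (cast_ord card3 (enum_rank x)).
pose d (y : S) : option bool := enum_val (cast_ord (esym card3) (g y)).
have eK : cancel e d by move=> x; rewrite /d /e fK cast_ordK enum_rankK.
have dK : cancel d e by move=> y; rewrite /d /e enum_valK cast_ordKV gK.
have e_hom := transport_hom (inhabits None) dK.
have [C_img _ _] := satisfies_absorption_closed X.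
apply: (C_img _ _ _ e_hom); first by move=> y; exists (d y).
apply: satisfies_absorption_table.
exact: (is_semiring_inj e_hom (can_inj eK)).
Qed.

(** Idempotence collapses [sextuple add x] to [x], and x + y + x to x + y. *)
Lemma absorbs_ai_semiring (A : algebra) (x y : A) :
  is_ai_semiring A -> absorbs add x y -> add x y = x.
Proof.
by move=> [[DA _ _ _] DC DI]; rewrite /absorbs /sextuple !DI DC DA DI.
Qed.

Theorem corollary7p4 : forall A : algebra, (V3 A /\ AI A) <-> A3 A.
Proof.
move=> A; split=> [[V3A aiA] | A3A].
  apply: A3_of_identities => t u id_tu.
  have absA : satisfies_absorption A A.
    apply: V3A; first exact: satisfies_absorption_closed.
    exact: satisfies_absorption_order_three.
  have ut_id : ai3_identity u t by move=> B B3 v; rewrite id_tu.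
  (* Replace t by t + u and u by u + t; [{2}] skips the u inside t + u. *)
  rewrite -(absorbs_ai_semiring aiA (absA _ _ id_tu id)).
  rewrite -{2}(absorbs_ai_semiring aiA (absA _ _ ut_id id)).
  by case: aiA => _ ->.
split.
- move=> C closedC KC; apply: A3A => // B [[semiB _ _] B3].
  exact: KC.
- by apply: A3A => [|B []]; first exact: is_ai_semiring_closed.
Qed.
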